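(* Let $T>0$, let $c_1,c_2\in\mathbb{R}$ with $c_1>c_2$, and let $0<a_1<a_2$. Put $t^*:=\frac{a_2-a_1}{c_1-c_2}$ and $$\pi_T(a_1,a_2):=\mathbb{P}\left(\sup_{t\in[0,T]}(B(t)-c_1t)>a_1,\ \sup_{t\in[0,T]}(B(t)-c_2t)>a_2\right),$$ where $\{B(t):t\ge 0\}$ is a standard Brownian motion. Suppose that $t^*\geq T$. Then $$\pi_{T}(a_1,a_2)=\Psi\left(\frac{a_2+c_2T}{\sqrt{T}}\right)+e^{-2a_2c_2}\,\Psi\left(\frac{a_2-c_2T}{\sqrt{T}}\right).$$
   Context: $\Psi(x)=\mathbb{P}(\mathcal{N}>x)$, where $\mathcal{N}$ is a standard normal random variable. A standard Brownian motion starts at $B(0)=0$. The number $t^*$ is the unique point of intersection of the lines $t\mapsto a_1+c_1t$ and $t\mapsto a_2+c_2t$. *)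

(* Defs.v *)
From HB Require Import structures.
From mathcomp Require Import all_boot all_order all_algebra.
From mathcomp Require Import all_classical all_reals all_analysis.
From mathcomp Require Import measurable_realfun.

Set Implicit Arguments.
Unset Strict Implicit.
Unset Printing Implicit Defensive.

Import Order.TTheory GRing.Theory Num.Theory.
Import numFieldNormedType.Exports.

Local Open Scope classical_set_scope.
Local Open Scope ring_scope.

(* The second argument of [normal_prob] is the standard deviation. *)
Definition Psi (R : realType) (x : R) : \bar R :=
  normal_prob (0 : R) (1 : R) `]x, +oo[.

(* Subfamilies are covered by taking [A i := setT] for the omitted indices. *)
Definition mutually_independent (d : measure_display) (Omega : measurableType d)
    (R : realType) (P : probability Omega R) (I : finType)
    (X : I -> {RV P >-> R}) : Prop :=
  forall A : I -> set R, (forall i, measurable (A i)) ->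
    P [set w | forall i, A i (X i w)] = (\prod_(i : I) P (X i @^-1` A i))%E.

(* The time index ranges over all of [R], but only measurability is assumed at
   negative times.  In [bm_gaussian] the inequality [s < t] is strict because
   [normal_prob m 0] is, by the library's convention, not the Dirac mass at
   [m]; the case [s = t] carries no information.  Starting point and path
   continuity are required for every outcome, which makes the events below
   measurable on a probability space that need not be complete. *)
Record brownian_motion (d : measure_display) (Omega : measurableType d)
    (R : realType) (P : probability Omega R) (B : R -> {RV P >-> R}) : Prop :=
  BrownianMotion {
    bm_start : forall w, B 0 w = 0;
    bm_indep : forall (n : nat) (t : nat -> R), 0 <= t 0%N ->
      (forall i, (i < n)%N -> t i <= t i.+1) ->
      mutually_independent
        (fun i : 'I_n => B (t i.+1) - B (t i) : {RV P >-> R});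
    bm_gaussian : forall s t : R, 0 <= s -> s < t ->
      forall A : set R, measurable A ->
      distribution P (B t - B s : {RV P >-> R}) A =
      normal_prob 0 (Num.sqrt (t - s)) A;
    bm_continuous : forall w, {within `[0, +oo[, continuous (fun t => B t w)}
  }.

Definition sup_drifted (d : measure_display) (Omega : measurableType d)
    (R : realType) (P : probability Omega R) (B : R -> {RV P >-> R})
    (T c : R) (w : Omega) : \bar R :=
  ereal_sup [set (B t w - c * t)%:E | t in `[0, T]].

Definition pi_T (d : measure_display) (Omega : measurableType d)
    (R : realType) (P : probability Omega R) (B : R -> {RV P >-> R})
    (T c1 c2 a1 a2 : R) : \bar R :=
  P [set w | (a1%:E < sup_drifted B T c1 w)%E /\ (a2%:E < sup_drifted B T c2 w)%E].

(* Main.v *)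
Require Import Defs.
From HB Require Import structures.
From mathcomp Require Import all_boot all_order all_algebra.
From mathcomp Require Import all_classical all_reals all_analysis.
From mathcomp Require Import measurable_realfun.
From mathcomp Require Import ring lra.
Set Implicit Arguments.
Unset Strict Implicit.
Unset Printing Implicit Defensive.
Import Order.TTheory GRing.Theory Num.Theory.
Import numFieldNormedType.Exports.
Local Open Scope classical_set_scope.
Local Open Scope ring_scope.

(** Up to time [T <= t^*] the line [a2 + c2 t] is not below [a1 + c1 t], so a path
    that exceeds the former has exceeded the latter: the joint event is the
    event that the upper line is crossed before [T] ([sup_drifted_gt] and the
    theorem itself).  What remains is the law of the supremum of a Brownian
    motion with drift ([hitting_probability]), proved here by a reflection
    principle that works directly with the drift.

    Write [Y_t = a + c t - B_t] for the gap between line and path.  A path with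
    [Y_T < 0] has crossed the line, which gives the first term.  For the paths
    that cross and come back, the claim is the identity
    [P (crossed, 0 < Y_T < K) = E (exp (- 2 c Y_T); - K < Y_T < 0)]
    ([reflection_principle]).  Its right-hand side is an explicit Gaussian
    integral, equal to [exp (- 2 a c)] times the mass that the normal law of
    mean [2 c T] gives to an interval
    ([integral_mirror_weight_start]); letting [K] tend to infinity produces the
    second term.  The truncation at [K] keeps the integrand bounded.

    The identity holds because a gap that starts at [0] and runs for a time [s]
    has a Gaussian law whose density at [- u] is [exp (- 2 c u)] times its density
    at [u]: mirroring the end point and weighting by [exp (- 2 c Y)] cancel.
    When the gap starts at [y <= 0] instead of [0], the two sides differ by the
    factor [exp (- 2 u y / s)], and hence by at most [exp (2 K |y| / s) - 1]
    ([integral_mirror_weight], [mirror_weight_le_normal_prob]).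

    The path is observed on the grid [k T / (n + 1)], [k <= n], and stopped at
    the first grid point where the gap is negative.  That event only depends on
    the increments up to that time, so it is independent of the remaining
    increment and Fubini's theorem reduces the matter to the Gaussian comparison
    ([integral_markov], [past_event_reflection]).  The error is controlled by the
    ratio between the overshoot at the stopping time and the time left.
    Continuity of paths makes this ratio tend to [0] on every crossing path: the
    stopping times approach the first crossing time, which is smaller than [T]
    and at which the gap vanishes ([first_grid_hit], [overshoot_cvg]).  Since
    all quantities are bounded, the identity follows by dominated convergence. *)

(** * Gaussian integrals *)

(** The Radon-Nikodym derivative of a normal law is only known almost
    everywhere; it agrees with the explicit density since both have the same
    integral over every measurable set. *)
Lemma integral_normal_prob (R : realType) (m s : R) (f : R -> \bar R) :
  measurable_fun setT f -> (forall x, 0 <= f x)%E ->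
  (\int[normal_prob m s]_x f x =
   \int[lebesgue_measure]_x (f x * (normal_pdf m s x)%:E))%E.
Proof.
move=> mf f0.
have numu := @normal_prob_dominates R m s.
rewrite -(Radon_Nikodym_SigmaFinite.change_of_variables numu)//.
have mpdf : measurable_fun setT (EFin \o normal_pdf m s).
  by apply/measurable_EFinP; exact: measurable_normal_pdf.
have iRN := Radon_Nikodym_SigmaFinite.f_integrable numu.
have mRN := measurable_int _ iRN.
have RNE : ae_eq lebesgue_measure setT
    (Radon_Nikodym_SigmaFinite.f (normal_prob m s) lebesgue_measure)
    (EFin \o normal_pdf m s).
  apply: integral_ae_eq => //= E _ mE.
  by rewrite -Radon_Nikodym_SigmaFinite.f_integral.
apply: ae_eq_integral => //; [exact: emeasurable_funM|exact: emeasurable_funM|].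
by move: RNE; apply: filterS => x /= + _ => ->.
Qed.

Lemma lebesgue_measure_reflect (R : realType) (r : R) (A : set R) :
  measurable A ->
  pushforward lebesgue_measure ((fun x => r - x) : _ -> measurableTypeR R) A =
  lebesgue_measure A.
Proof.
have mr : measurable_fun setT ((fun x => r - x) : R -> measurableTypeR R).
  exact: measurable_funB.
pose phi : {mfun R >-> measurableTypeR R} :=
  HB.pack (fun x : R => r - x : measurableTypeR R) (isMeasurableFun.Build _ _ _ _ _ mr).
move=> mA.
apply/esym/(@lebesgue_measure_unique _ (pushforward lebesgue_measure phi)) => //= _ [[a b]] _ <-.
rewrite /pushforward /=.
have -> : (fun x => r - x) @^-1` `]a, b] = `[r - b, r - a[%classic.
  by apply/seteqP; split => x /=; rewrite !in_itv/=; lra.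
rewrite !lebesgue_measure_itv/= !lte_fin.
have -> : (r - b < r - a) = (a < b) by lra.
by case: ifP => // _; rewrite -!EFinD; congr EFin; ring.
Qed.

Lemma ge0_integral_reflect (R : realType) (r : R) (f : R -> \bar R) :
  measurable_fun setT f -> (forall x, 0 <= f x)%E ->
  (\int[lebesgue_measure]_x f x = \int[lebesgue_measure]_x f (r - x)%R)%E.
Proof.
move=> mf f0.
have mr : measurable_fun setT ((fun x => r - x) : R -> measurableTypeR R).
  exact: measurable_funB.
transitivity (\int[pushforward lebesgue_measure
     ((fun x => r - x)%R : _ -> measurableTypeR R)]_x f x)%E.
  by apply: eq_measure_integral => A mA _; exact/esym/lebesgue_measure_reflect.
by rewrite ge0_integral_pushforward.
Qed.

(** The body of [normal_pdf] goes through a constant local to its section;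
    this form can be rewritten with. *)
Lemma normal_pdf_expE (R : realType) (m s x : R) : s != 0 ->
  normal_pdf m s x = normal_peak s * expR (- (x - m) ^+ 2 / (s ^+ 2 *+ 2)).
Proof. by move=> s0; rewrite normal_pdfE. Qed.

Lemma normal_pdf_standardize (R : realType) (m s x : R) : 0 < s ->
  normal_pdf m s x = normal_pdf 0 1 ((x - m) / s) * s^-1.
Proof.
move=> s0; have s_neq0 : s != 0 by rewrite gt_eqF.
rewrite !normal_pdf_expE ?oner_neq0// mulrAC.
have -> : normal_peak s = normal_peak 1 * s^-1.
  rewrite /normal_peak -2!mulrnAr sqrtrM ?sqr_ge0// sqrtr_sqr gtr0_norm//.
  by rewrite expr1n mul1r invfM mulrC.
by congr (_ * expR _); field.
Qed.

Lemma normal_prob_ray (R : realType) (m s b : R) : 0 < s ->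
  normal_prob m s `]b, +oo[ = Psi ((b - m) / s).
Proof.
move=> s0; rewrite /Psi /normal_prob.
have s_neq0 : s != 0 by rewrite gt_eqF.
have mpdf n t : measurable_fun (setT : set R) (EFin \o normal_pdf n t).
  by apply/measurable_EFinP; exact: measurable_normal_pdf.
rewrite !integral_itv_obnd_cbnd; [|apply: measurable_funTS; exact: mpdf..].
pose F (x : R) : R := (x - m) / s.
have dF x : is_derive x (1 : R) F (s^-1).
  by apply: is_derive_eq; rewrite scaler0 subr0 add0r /GRing.scale/= mulr1.
have F'E : F^`()%classic = cst s^-1.
  by apply/funext => x; rewrite derive1E derive_val.
rewrite (@increasing_ge0_integration_by_substitutiony _ F).
- by apply: eq_integral => x _; rewrite F'E normal_pdf_standardize.
- move=> x y _ _ xy; rewrite /F; rewrite ltr_pM2r ?invr_gt0//; lra.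
- by rewrite F'E => x _; exact: cvg_cst.
- by rewrite F'E; exact: is_cvg_cst.
- by rewrite F'E; exact: is_cvg_cst.
- split; first by move=> x _; exact: ex_derive.
  apply: cvg_at_right_filter; apply: differentiable_continuous.
  apply/derivable1_diffP; exact: ex_derive.
- apply: gt0_cvgMly; first by rewrite invr_gt0.
  exact: cvg_addrr.
- apply: continuous_subspaceT; apply: continuous_normal_pdf; exact: oner_neq0.
- by move=> x _; exact: normal_pdf_ge0.
Qed.

(** * The Gaussian reflection comparison *)

(** For a gap with drift [c] that starts at [0], the factor [exp (- 2 c u)] is
    the quotient of the densities at [- u] and at [u], whatever the time is;
    cutting at [- K] keeps the weight bounded when [c] is positive. *)
Definition mirror_weight (R : realType) (c K u : R) : R :=
  expR (- (2 * c * u)) * \1_`]-K, 0[%classic u.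

Lemma measurable_mirror_weight (R : realType) (c K : R) :
  measurable_fun setT (mirror_weight c K).
Proof.
apply: measurable_funM; last exact: measurable_indic.
apply: measurableT_comp; first exact: measurable_expR.
apply: measurableT_comp; first exact: oppr_measurable.
exact: measurable_funM.
Qed.

Lemma mirror_weight_ge0 (R : realType) (c K u : R) : 0 <= mirror_weight c K u.
Proof. by rewrite mulr_ge0// expR_ge0. Qed.

Lemma mirror_weight_le (R : realType) (c K u : R) :
  mirror_weight c K u <= expR (2 * `|c| * K).
Proof.
rewrite /mirror_weight indicE; have [|_] := boolP (_ \in _); last by rewrite mulr0 expR_ge0.
rewrite inE/= in_itv/= => /andP[Ku u0]; rewrite mulr1 ler_expR.
have c1 : c <= `|c| := ler_norm c.
have c2 : - c <= `|c| by rewrite -normrN; exact: ler_norm.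
have c0 : 0 <= `|c| by [].
nra.
Qed.

Lemma measurable_tilted_indic (R : realType) (b y s K : R) :
  measurable_fun setT
    (fun x : R => expR (- (2 * (b - x) * y / s)) * \1_`]0, K[%classic (b - x)).
Proof.
have mb : measurable_fun setT (fun x : R => b - x) by exact: measurable_funB.
apply: measurable_funM; last first.
  by apply: measurableT_comp => //; exact: measurable_indic.
apply: measurableT_comp; first exact: measurable_expR.
apply: measurableT_comp; first exact: oppr_measurable.
by do 2 apply: measurable_funM => //; exact: measurable_funM.
Qed.

(** The integrand on the right is the mirror image of the weight: under the
    reflection [x |-> 2 (y + c s) - x] the value [u = y + c s - x] becomes [- u],
    and the quotient of the Gaussian densities at the two points is
    [exp (- 2 u (y + c s) / s)].  The drift part [exp (- 2 c u)] of this quotient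
    cancels the weight [exp (2 c u)] at [- u], which leaves [exp (- 2 u y / s)].
    For [y = 0] the right-hand side is the mass of a band. *)
Lemma integral_mirror_weight (R : realType) (c K s y : R) : 0 < s ->
  (\int[normal_prob 0 (Num.sqrt s)]_x (mirror_weight c K (y + c * s - x))%:E =
   \int[normal_prob 0 (Num.sqrt s)]_x
     (expR (- (2 * (y + c * s - x) * y / s)) *
       \1_`]0, K[%classic (y + c * s - x))%:E)%E.
Proof.
move=> s0.
have ss0 : Num.sqrt s != 0 :> R by rewrite gt_eqF// sqrtr_gt0.
have mu : measurable_fun setT (fun x : R => y + c * s - x).
  exact: measurable_funB.
have mpdf : measurable_fun setT (fun x : R => (normal_pdf 0 (Num.sqrt s) x)%:E).
  by apply/measurable_EFinP; exact: measurable_normal_pdf.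
rewrite !integral_normal_prob.
- rewrite (ge0_integral_reflect (2 * (y + c * s))).
  + apply: eq_integral => x _; rewrite -!EFinM; congr EFin.
    rewrite !normal_pdf_expE// /mirror_weight !indicE.
    have -> : (y + c * s - (2 * (y + c * s) - x) \in `]-K, 0[%classic) =
              (y + c * s - x \in `]0, K[%classic).
      by apply/idP/idP; rewrite !inE/= !in_itv/=; lra.
    case: (_ \in _); last by rewrite !mulr0 !mul0r.
    rewrite !mulr1 mulrCA [RHS]mulrCA; congr (_ * _); rewrite -!expRD; congr expR.
    by rewrite sqr_sqrtr ?ltW//; field; rewrite gt_eqF.
  + apply: emeasurable_funM => //; apply/measurable_EFinP.
    exact: (measurableT_comp (measurable_mirror_weight c K)).
  + by move=> x; rewrite -EFinM lee_fin mulr_ge0 ?mirror_weight_ge0 ?normal_pdf_ge0.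
- by apply/measurable_EFinP; exact: measurable_tilted_indic.
- by move=> x; rewrite lee_fin mulr_ge0// expR_ge0.
- apply/measurable_EFinP.
  exact: (measurableT_comp (measurable_mirror_weight c K)).
- by move=> x; rewrite lee_fin mirror_weight_ge0.
Qed.

Definition band (R : realType) (b K : R) : set R :=
  (fun x => b - x) @^-1` `]0, K[.

Lemma measurable_band (R : realType) (b K : R) : measurable (band b K).
Proof.
rewrite -[X in measurable X]setTI.
have mf : measurable_fun setT (fun x : R => b - x) by exact: measurable_funB.
exact: mf.
Qed.

Lemma mem_band (R : realType) (b K x : R) :
  (x \in band b K) = (b - x \in `]0, K[%classic).
Proof. by apply/idP/idP; rewrite !inE. Qed.

(** After mirroring, the exponential factor is at least [1] because
    [u > 0] and [y <= 0]. *)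
Lemma normal_prob_le_mirror_weight (R : realType) (c K s y : R) :
  0 < s -> y <= 0 ->
  (normal_prob 0 (Num.sqrt s) (band (y + c * s) K) <=
   \int[normal_prob 0 (Num.sqrt s)]_x (mirror_weight c K (y + c * s - x))%:E)%E.
Proof.
move=> s0 y0; rewrite integral_mirror_weight//.
have mA := measurable_band (y + c * s) K.
rewrite -(setIT (band _ _)) -integral_indic//.
apply: ge0_le_integral => //=.
- exact/measurable_EFinP.
- by apply/measurable_EFinP; exact: measurable_tilted_indic.
move=> x _; rewrite lee_fin !indicE.
rewrite mem_band.
have [|_] := boolP (_ \in _); last by rewrite mulr0.
rewrite inE/= in_itv/= => /andP[u0 _].
rewrite mulr1 -[leLHS]expR0 ler_expR -mulNr.
by rewrite mulr_ge0 ?invr_ge0 ?(ltW s0)//; nra.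
Qed.

(** The first bound in the minimum holds whatever the overshoot [- y] is and
    serves as the dominating constant; the second one makes the error small
    when the overshoot is small compared with the remaining time [s]. *)
Lemma mirror_weight_le_normal_prob (R : realType) (c K s y : R) :
  0 <= K -> 0 < s -> y <= 0 ->
  (\int[normal_prob 0 (Num.sqrt s)]_x (mirror_weight c K (y + c * s - x))%:E <=
   normal_prob 0 (Num.sqrt s) (band (y + c * s) K) +
   (Num.min (expR (2 * `|c| * K)) (expR (2 * K * (- y / s)) - 1))%:E)%E.
Proof.
move=> K0 s0 y0.
have mA := measurable_band (y + c * s) K.
set A := band _ _; set N := normal_prob _ _; set C := expR (2 * `|c| * K).
pose D : R := expR (2 * K * (- y / s)).
have [p pE] : exists p : R, N A = p%:E.
  have : N A \is a fin_num by apply: fin_num_measure.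
  by case: (N A) => // p _; exists p.
have p0 : 0 <= p by rewrite -lee_fin -pE.
have p1 : p <= 1 by rewrite -lee_fin -pE; exact: probability_le1.
have IC : (\int[N]_x (mirror_weight c K (y + c * s - x))%:E <= C%:E)%E.
  rewrite -[leRHS]mule1 -(probability_setT N) -integral_cst//.
  apply: ge0_le_integral => //=.
  - by move=> x _; rewrite lee_fin mirror_weight_ge0.
  - apply/measurable_EFinP; apply: (measurableT_comp (measurable_mirror_weight c K)).
    exact: measurable_funB.
  - by move=> x _; rewrite lee_fin; exact: mirror_weight_le.
have ID : (\int[N]_x (mirror_weight c K (y + c * s - x))%:E <= D%:E * N A)%E.
  have -> : N A = (\int[N]_x (\1_A x)%:E)%E by rewrite integral_indic// setIT.
  rewrite integral_mirror_weight// -/N.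
  rewrite -ge0_integralZl//; last 2 first.
  - exact/measurable_EFinP.
  - by rewrite lee_fin expR_ge0.
  apply: ge0_le_integral => //=.
  - by apply/measurable_EFinP; exact: measurable_tilted_indic.
  - by apply: emeasurable_funM => //; exact/measurable_EFinP.
  move=> x _; rewrite -EFinM lee_fin !indicE.
  rewrite mem_band.
  have [|_] := boolP (_ \in _); last by rewrite !mulr0.
  rewrite inE/= in_itv/= => /andP[u0 uK].
  rewrite !mulr1 ler_expR -mulNr mulrA ler_pM2r ?invr_gt0//; nra.
move: IC ID; rewrite pE; case: (\int[N]_x _)%E => [q| |]//=; last first.
  by move=> _ _; rewrite leNye.
rewrite -EFinM -EFinD !lee_fin => qC qD.
have D1 : 1 <= D.
  rewrite /D -[leLHS]expR0 ler_expR mulr_ge0 ?mulr_ge0 ?invr_ge0 ?(ltW s0)//.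
  by rewrite oppr_ge0.
rewrite -lerBlDl le_min -/D; apply/andP; split; first lra.
have : (D - 1) * p <= (D - 1) * 1 by rewrite ler_wpM2l// subr_ge0.
lra.
Qed.

(** Completing the square: for [u = a + c T - x] one has
    [- 2 c u - x^2 / (2 T) = - 2 a c - (x - 2 c T)^2 / (2 T)]. *)
Lemma integral_mirror_weight_start (R : realType) (a c K T : R) : 0 < T ->
  (\int[normal_prob 0 (Num.sqrt T)]_x (mirror_weight c K (a + c * T - x))%:E =
   (expR (- (2 * a * c)))%:E *
   normal_prob (2 * c * T) (Num.sqrt T) `](a + c * T)%R, (a + c * T + K)%R[)%E.
Proof.
move=> T0.
have sT0 : Num.sqrt T != 0 :> R by rewrite gt_eqF// sqrtr_gt0.
have mpdf m : measurable_fun setT (fun x : R => (normal_pdf m (Num.sqrt T) x)%:E).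
  by apply/measurable_EFinP; exact: measurable_normal_pdf.
rewrite integral_normal_prob; last 2 first.
- apply/measurable_EFinP; apply: (measurableT_comp (measurable_mirror_weight c K)).
  exact: measurable_funB.
- by move=> x; rewrite lee_fin mirror_weight_ge0.
rewrite /normal_prob -ge0_integralZl//; last 2 first.
- by apply: measurable_funTS; exact: mpdf.
- by move=> x _; rewrite lee_fin normal_pdf_ge0.
rewrite [RHS]integral_mkcond; apply: eq_integral => x _.
rewrite patchE /mirror_weight indicE.
have -> : (x \in `]a + c * T, a + c * T + K[%classic) =
          (a + c * T - x \in `]-K, 0[%classic).
  by apply/idP/idP; rewrite !inE/= !in_itv/=; lra.
case: (_ \in _); last by rewrite mulr0 mul0e.
rewrite mulr1 -!EFinM !normal_pdf_expE//; congr EFin.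
rewrite mulrCA [RHS]mulrCA; congr (_ * _); rewrite -!expRD; congr expR.
by rewrite sqr_sqrtr ?ltW//; field; rewrite gt_eqF.
Qed.

(** * Independence of past and future *)

(** The joint law of independent variables is the product of their laws, so
    Fubini's theorem allows to integrate out [X] with [U] frozen.  The type [T1]
    is arbitrary in order to let [U] be the identity towards [Omega] equipped
    with a smaller sigma-algebra. *)
Lemma integral_independent d1 d2 d3 (Omega : measurableType d1)
    (T1 : measurableType d2) (T2 : measurableType d3) (R : realType)
    (P : probability Omega R)
    (U : {mfun Omega >-> T1}) (X : {mfun Omega >-> T2}) (f : T1 * T2 -> \bar R) :
  (forall A C, measurable A -> measurable C ->
    P (U @^-1` A `&` X @^-1` C) = P (U @^-1` A) * P (X @^-1` C))%E ->
  measurable_fun setT f -> (forall z, 0 <= f z)%E ->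
  (\int[P]_w f (U w, X w) =
   \int[P]_w \int[distribution P X]_x f (U w, x))%E.
Proof.
move=> UX mf f0.
have mUX : measurable_fun setT (fun w => (U w, X w)) by exact: measurable_fun_pair.
pose UXf : {mfun Omega >-> (T1 * T2)%type} :=
  HB.pack (fun w => (U w, X w)) (isMeasurableFun.Build _ _ _ _ _ mUX).
transitivity (\int[distribution P UXf]_z f z)%E.
  by rewrite ge0_integral_distribution.
transitivity (\int[(distribution P U \x distribution P X)%E]_z f z)%E.
  apply: eq_measure_integral => A mA _.
  symmetry; apply: (@product_measure_unique _ _ _ _ _ (distribution P U)
    (distribution P X) (distribution P UXf)) => //.
rewrite fubini_tonelli1// ge0_integral_distribution//.
- exact: measurable_fun_fubini_tonelli_F.
- by move=> x; apply: integral_ge0.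
Qed.

(** Dynkin's argument: [E |-> P (E `&` D)] and [E |-> P E * P D] are finite
    measures which agree on a pi-system, hence on the sigma-algebra that it
    generates. *)
Lemma g_sigma_algebra_independent d (Omega : measurableType d) (R : realType)
    (P : probability Omega R) (G : set (set Omega)) (D : set Omega) :
  G `<=` measurable -> setI_closed G -> G setT -> measurable D ->
  (forall E, G E -> P (E `&` D) = P E * P D)%E ->
  forall E, <<s G >> E -> (P (E `&` D) = P E * P D)%E.
Proof.
move=> Gm GI GT mD GD E sE.
have PD0 : 0 <= fine (P D) by rewrite fine_ge0.
have PDE : ((NngNum PD0)%:num%:E = P D)%E by rewrite /= fineK// fin_num_measure.
pose m1 : {measure set Omega -> \bar R} := mrestr P mD.
pose m2 : {measure set Omega -> \bar R} := mscale (NngNum PD0) P.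
transitivity (m1 E) => //; rewrite muleC.
transitivity (m2 E); last by rewrite /m2/= /mscale PDE.
apply: (g_sigma_algebra_measure_unique G Gm (fun=> setT)) => //.
- by apply/seteqP; split => // x _; exists 0%N.
- move=> A GA; rewrite /m1/= /mrestr GD//.
  by rewrite /m2/= /mscale PDE muleC.
- move=> k; rewrite /m1/= /mrestr setTI.
  exact: le_lt_trans (probability_le1 _ _) (ltry _).
Qed.

(** A pi-system on which independence can be read off the definition of a
    Brownian motion.  As [B] starts at [0], it generates the sigma-algebra of
    [B (t 0), ..., B (t k)] when [t 0 = 0]. *)
Definition increment_rectangles d (Omega : measurableType d) (R : realType)
    (P : probability Omega R) (B : R -> {RV P >-> R}) (t : nat -> R) (k : nat) :
    set (set Omega) :=
  [set E | exists2 A : nat -> set R, (forall i, measurable (A i)) &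
     E = [set w | forall i, (i < k)%N -> A i (B (t i.+1) w - B (t i) w)]].

Lemma increment_rectangles_measurable d (Omega : measurableType d)
    (R : realType) (P : probability Omega R) (B : R -> {RV P >-> R})
    (t : nat -> R) (k : nat) :
  increment_rectangles B t k `<=` measurable.
Proof.
move=> _ [A mA ->].
rewrite (_ : [set _ | _] = \bigcap_i
    ((B (t i.+1) - B (t i) : {mfun Omega >-> R}) @^-1`
      (if (i < k)%N then A i else setT))).
  apply: bigcapT_measurable => i; apply: measurable_funPTI.
  by case: ifP.
apply/seteqP; split => w /= Aw i; first by move=> _; case: ifPn => //; exact: Aw.
by move=> ik; have := Aw i I; rewrite /= ik.
Qed.

Lemma past_sub_measurable d (Omega : measurableType d)
    (R : realType) (P : probability Omega R) (B : R -> {RV P >-> R})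
    (t : nat -> R) (k : nat) :
  <<s increment_rectangles B t k >> `<=` measurable.
Proof.
apply: smallest_sub; first exact: sigma_algebra_measurable.
exact: increment_rectangles_measurable.
Qed.

Lemma increment_rectangles_setI d (Omega : measurableType d)
    (R : realType) (P : probability Omega R) (B : R -> {RV P >-> R})
    (t : nat -> R) (k : nat) :
  setI_closed (increment_rectangles B t k).
Proof.
move=> _ _ [A mA ->] [C mC ->]; exists (fun i => A i `&` C i).
  by move=> i; exact: measurableI.
apply/seteqP; split => w /=; first by move=> [Aw Cw] i ik; split; [exact: Aw|exact: Cw].
by move=> AC; split => i /AC[].
Qed.

Lemma increment_rectangles_setT d (Omega : measurableType d)
    (R : realType) (P : probability Omega R) (B : R -> {RV P >-> R})
    (t : nat -> R) (k : nat) :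
  increment_rectangles B t k setT.
Proof. by exists (fun=> setT) => //; apply/seteqP; split. Qed.

(** [B (t j)] is the sum of the first [j] increments, since [B] starts at [0]. *)
Lemma past_measurable d (Omega : measurableType d)
    (R : realType) (P : probability Omega R) (B : R -> {RV P >-> R})
    (hB : brownian_motion B) (t : nat -> R) (k j : nat) : t 0%N = 0 -> (j <= k)%N ->
  measurable_fun setT
    (B (t j) : g_sigma_algebraType (increment_rectangles B t k) -> R).
Proof.
move=> t0; elim: j => [_|j IH jk].
  rewrite t0 (_ : B 0 = cst 0 :> (_ -> _)); first exact: measurable_cst.
  by apply/funext => w; exact: bm_start.
rewrite (_ : B (t j.+1) = (fun w => B (t j) w + (B (t j.+1) w - B (t j) w)) :> (_ -> _)).
  apply: measurable_funD; first exact: IH (ltnW jk).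
  move=> _ C mC; rewrite setTI; apply: sub_sigma_algebra.
  exists (fun i => if i == j then C else setT); first by move=> i; case: ifP.
  apply/seteqP; split => w /= h.
    by move=> i _; case: ifP => // /eqP ->.
  by have := h _ jk; rewrite eqxx.
by apply/funext => w; rewrite addrC subrK.
Qed.

(** The increments along [t 0, ..., t k, T] are mutually independent; taking
    the whole line as last condition identifies the product of the first [k]
    factors with the probability of the rectangle. *)
Lemma increment_rectangles_independent d (Omega : measurableType d)
    (R : realType) (P : probability Omega R) (B : R -> {RV P >-> R})
    (hB : brownian_motion B) (t : nat -> R) (k : nat) (T : R) (E : set Omega) (C : set R) :
  t 0%N = 0 -> (forall i, (i < k)%N -> t i <= t i.+1) -> t k <= T ->
  increment_rectangles B t k E -> measurable C ->
  P (E `&` (fun w => B T w - B (t k) w) @^-1` C) =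
  (P E * P ((fun w => (B T w - B (t k) w)%R) @^-1` C))%E.
Proof.
move=> t0 tS tT [A mA EE] mC.
(* its first k + 1 increments are those of the past and the one up to T *)
pose t' i := if (i <= k)%N then t i else T.
have t'0 : 0 <= t' 0%N by rewrite /t' t0.
have t'S i : (i < k.+1)%N -> t' i <= t' i.+1.
  rewrite ltnS => ik; rewrite /t' ik; case: ifPn => [|ik']; first exact: tS.
  by have -> : i = k by apply/eqP; rewrite eqn_leq ik leqNgt.
have ind := bm_indep hB t'0 t'S.
have indep D : measurable D ->
    P (E `&` (fun w => B T w - B (t k) w) @^-1` D) =
    ((\prod_(i < k) P ((B (t i.+1) - B (t i) : {mfun Omega >-> R})%R @^-1` A i)) *
     P ((fun w => (B T w - B (t k) w)%R) @^-1` D))%E.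
  move=> mD.
  pose A' (i : 'I_k.+1) := if (i < k)%N then A i else D.
  have mA' i : measurable (A' i) by rewrite /A'; case: ifP.
  have := ind A' mA'; rewrite big_ord_recr /= => H.
  rewrite (_ : _ `&` _ =
    [set w | forall i : 'I_k.+1, A' i ((B (t' i.+1) - B (t' i)) w)]).
    rewrite H; congr (_ * _)%E.
      apply: eq_bigr => i _; rewrite /A' /= ltn_ord.
      by rewrite /t' ltn_ord ltnW.
    by rewrite /A' /= ltnn /t' ltnn leqnn.
  rewrite EE; apply/seteqP; split => w /=.
    move=> [Aw Dw] i; rewrite /A' /t'; have := ltn_ord i; rewrite ltnS => ik.
    rewrite ik; case: ifPn => ik'; first exact: Aw.
    by have -> : nat_of_ord i = k by apply/eqP; rewrite eqn_leq ik leqNgt.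
  move=> Aw; split.
    move=> i ik; have := Aw (Ordinal (ltnW ik : (i < k.+1)%N)).
    by rewrite /A' /t' /= ik ltnW.
  by have := Aw ord_max; rewrite /A' /t' /= ltnn leqnn.
rewrite indep//; congr (_ * _)%E.
have := indep setT measurableT.
by rewrite preimage_setT setIT probability_setT mule1.
Qed.

Definition gap (Omega : Type) (R : realType) (B : R -> Omega -> R)
  (a c t : R) (w : Omega) : R := a + c * t - B t w.

Lemma measurable_gap d (Omega : measurableType d) (R : realType)
    (P : probability Omega R) (B : R -> {RV P >-> R}) (a c t : R) :
  measurable_fun setT (gap B a c t).
Proof. exact: measurable_funB. Qed.

(** The Markov property at time [t k]: on an event of the past, the gap at
    time [T] is the gap at time [t k] plus the drift, minus an independent
    Gaussian increment. *)
Lemma integral_markov d (Omega : measurableType d) (R : realType)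
    (P : probability Omega R) (B : R -> {RV P >-> R})
    (hB : brownian_motion B) (t : nat -> R) (k : nat) (T a c : R)
    (E : set Omega) (f : R -> R) :
  t 0%N = 0 -> (forall i, (i < k)%N -> t i <= t i.+1) -> 0 <= t k -> t k < T ->
  <<s increment_rectangles B t k >> E ->
  measurable_fun setT f -> (forall x, 0 <= f x) ->
  (\int[P]_(w in E) (f (gap B a c T w))%:E =
   \int[P]_(w in E) \int[normal_prob 0 (Num.sqrt (T - t k))]_x
     (f (gap B a c (t k) w + c * (T - t k) - x))%:E)%E.
Proof.
move=> t0 tS tk0 tT sE mf f0.
pose G := increment_rectangles B t k.
have Gm : <<s G >> `<=` measurable by exact: past_sub_measurable.
have mE : measurable E by exact: Gm.
have mid : measurable_fun setT (id : Omega -> g_sigma_algebraType G).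
  by move=> _ A mA; rewrite setTI; exact: Gm.
(* the past, seen as the identity towards the smaller sigma-algebra *)
pose U : {mfun Omega >-> g_sigma_algebraType G} :=
  HB.pack (id : Omega -> g_sigma_algebraType G) (isMeasurableFun.Build _ _ _ _ _ mid).
have mX : measurable_fun setT ((fun w => B T w - B (t k) w) : Omega -> measurableTypeR R).
  exact: measurable_funB.
pose X : {mfun Omega >-> measurableTypeR R} :=
  HB.pack ((fun w => B T w - B (t k) w) : Omega -> measurableTypeR R)
    (isMeasurableFun.Build _ _ _ _ _ mX).
pose F (z : g_sigma_algebraType G * measurableTypeR R) : \bar R :=
  (\1_E z.1 * f (gap B a c (t k) z.1 + c * (T - t k) - z.2))%:E.
have mgap : measurable_fun setT (gap B a c (t k) : g_sigma_algebraType G -> R).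
  by apply: measurable_funB => //; exact: past_measurable.
have mF : measurable_fun setT F.
  apply/measurable_EFinP; apply: measurable_funM.
    have mE' : measurable_fun setT (\1_E : g_sigma_algebraType G -> R).
      exact: measurable_indic.
    exact: (measurableT_comp mE' measurable_fst).
  apply: (measurableT_comp mf); apply: measurable_funB => //.
  apply: measurable_funD => //.
  exact: (measurableT_comp mgap measurable_fst).
have F0 z : (0 <= F z)%E by rewrite lee_fin mulr_ge0.
have UX A C : measurable A -> measurable C ->
    (P (U @^-1` A `&` X @^-1` C) = P (U @^-1` A) * P (X @^-1` C))%E.
  move=> mA mC.
  suff key : forall D, <<s G >> D ->
      (P (D `&` X @^-1` C) = P D * P (X @^-1` C))%E by exact: key.
  apply: (@g_sigma_algebra_independent d Omega R P G (X @^-1` C)).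
  - exact: increment_rectangles_measurable.
  - exact: increment_rectangles_setI.
  - exact: increment_rectangles_setT.
  - exact: measurable_funPTI.
  - by move=> D GD; exact: (increment_rectangles_independent hB t0 tS (ltW tT) GD mC).
have XN := bm_gaussian hB tk0 tT.
transitivity (\int[P]_w F (U w, X w))%E.
  rewrite integral_mkcond; apply: eq_integral => w _.
  rewrite patchE /F /= indicE; case: (_ \in _); rewrite ?mul1r ?mul0r//.
  congr (f _)%:E.
  transitivity (gap B a c (t k) w + c * (T - t k) - (B T w - B (t k) w)) => //.
  by rewrite /gap; ring.
rewrite (integral_independent UX mF F0) [RHS]integral_mkcond.
apply: eq_integral => w _; rewrite patchE.
transitivity (\int[normal_prob 0 (Num.sqrt (T - t k))]_x F (U w, x))%E.
  by apply: eq_measure_integral => A mA _; exact: XN.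
rewrite /F /= indicE; case: (_ \in _).
  by apply: eq_integral => x _; rewrite mul1r.
by rewrite integral0_eq// => x _; rewrite mul0r.
Qed.

Lemma measurable_integral_shift (R : realType) (s : R) (f : R -> R) :
  measurable_fun setT f -> (forall x, 0 <= f x) ->
  measurable_fun setT
    (fun y : R => \int[normal_prob 0 s]_x (f (y - x))%:E)%E.
Proof.
move=> mf f0.
pose F (z : R * measurableTypeR R) : \bar R := (f (z.1 - z.2))%:E.
have mF : measurable_fun setT F.
  apply/measurable_EFinP; apply: (measurableT_comp mf).
  exact: measurable_funB.
apply: (@measurable_fun_fubini_tonelli_F _ _ _ _ _ (normal_prob 0 s) F mF).
by move=> z; rewrite lee_fin.
Qed.

Lemma measurable_mirror_bound (R : realType) (C K s : R) :
  measurable_fun setT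
    (fun y : R => Num.min C (expR (2 * K * (- y / s)) - 1)).
Proof.
apply: measurable_minr => //; apply: measurable_funB => //.
apply: measurableT_comp; first exact: measurable_expR.
by apply: measurable_funM => //; exact: measurable_funM.
Qed.

Lemma integral_indic_band (R : realType) (b K s : R) :
  (\int[normal_prob 0 s]_x (\1_`]0%R, K[%classic (b - x)%R)%:E =
   normal_prob 0 s (band b K))%E.
Proof.
rewrite -[RHS](_ : \int[normal_prob 0 s]_x (\1_(band b K) x)%:E = _)%E.
  by apply: eq_integral => x _; rewrite !indicE mem_band.
by rewrite integral_indic ?setIT//; exact: measurable_band.
Qed.

Lemma mirror_bound_ge0 (R : realType) (c K s y : R) :
  0 <= K -> 0 < s -> y <= 0 ->
  0 <= Num.min (expR (2 * `|c| * K)) (expR (2 * K * (- y / s)) - 1).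
Proof.
move=> K0 s0 y0; rewrite le_min expR_ge0 subr_ge0 -[leLHS]expR0 ler_expR.
by rewrite mulr_ge0 ?mulr_ge0 ?invr_ge0 ?(ltW s0)// oppr_ge0.
Qed.

(** The reflection principle for one event of the past on which the line has
    been crossed at time [t k].  It is not an equality because a path observed
    at discrete times overshoots the line. *)
Lemma past_event_reflection d (Omega : measurableType d) (R : realType)
    (P : probability Omega R) (B : R -> {RV P >-> R})
    (hB : brownian_motion B) (t : nat -> R) (k : nat) (T a c K : R)
    (E : set Omega) :
  t 0%N = 0 -> (forall i, (i < k)%N -> t i <= t i.+1) -> 0 <= t k -> t k < T ->
  <<s increment_rectangles B t k >> E -> 0 <= K ->
  (forall w, E w -> gap B a c (t k) w <= 0) ->
  (P (E `&` gap B a c T @^-1` `]0%R, K[) <=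
     \int[P]_(w in E) (mirror_weight c K (gap B a c T w))%:E <=
   P (E `&` gap B a c T @^-1` `]0%R, K[) +
     \int[P]_(w in E) (Num.min (expR (2 * `|c| * K)%R)
       (expR (2 * K * (- gap B a c (t k) w / (T - t k)))%R - 1)%R)%:E)%E.
Proof.
move=> t0 tS tk0 tT sE K0 Eneg.
have s0 : 0 < T - t k by rewrite subr_gt0.
have mE : measurable E by exact: past_sub_measurable sE.
have mfI : measurable_fun setT (\1_`]0, K[%classic : R -> R).
  exact: measurable_indic.
have mgap := measurable_gap B a c.
have -> : P (E `&` gap B a c T @^-1` `]0%R, K[) =
    (\int[P]_(w in E) (\1_`]0%R, K[%classic (gap B a c T w))%:E)%E.
  have mV : measurable (gap B a c T @^-1` `]0, K[).
    by rewrite -[X in measurable X]setTI; exact: mgap.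
  rewrite setIC -(integral_indic P mE mV).
  by apply: eq_integral => w _; rewrite !indicE; congr (nat_of_bool _)%:R%:E;
    apply/idP/idP; rewrite !inE.
rewrite !(integral_markov hB a c t0 tS tk0 tT sE)//; last first.
- by move=> x; exact: mirror_weight_ge0.
- exact: measurable_mirror_weight.
have mL (f : R -> R) : measurable_fun setT f -> (forall x : R, 0 <= f x) ->
  measurable_fun E (fun w => \int[normal_prob 0 (Num.sqrt (T - t k))]_x
    (f (gap B a c (t k) w + c * (T - t k) - x)%R)%:E)%E.
  move=> mf f0; apply: measurable_funTS.
  apply: (measurableT_comp (measurable_integral_shift _ mf f0)).
  exact: measurable_funD.
have mI := mL _ mfI (fun x => ler0n _ _).
have mM := mL _ (measurable_mirror_weight c K) (mirror_weight_ge0 c K).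
have mb : measurable_fun E (fun w => (Num.min (expR (2 * `|c| * K)%R)
       (expR (2 * K * (- gap B a c (t k) w / (T - t k)))%R - 1)%R)%:E).
  apply: measurable_funTS; apply/measurable_EFinP.
  exact: (measurableT_comp (measurable_mirror_bound _ K (T - t k)) (mgap (t k))).
apply/andP; split.
  apply: ge0_le_integral => //.
  - by move=> w _; apply: integral_ge0.
  - move=> w Ew; rewrite integral_indic_band.
    by apply: normal_prob_le_mirror_weight => //; exact: Eneg.
rewrite -ge0_integralD//; last 2 first.
- by move=> w _; apply: integral_ge0.
- by move=> w Ew; rewrite lee_fin mirror_bound_ge0// Eneg.
apply: ge0_le_integral => //.
- by move=> w _; apply: integral_ge0 => x _; rewrite lee_fin mirror_weight_ge0.
- exact: emeasurable_funD.
- move=> w Ew; rewrite integral_indic_band.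
  by apply: mirror_weight_le_normal_prob => //; exact: Eneg.
Qed.

(** * The first grid point after a crossing *)

(** Let [tau] be the infimum of the times at which [f] is negative.  By
    continuity [f tau] is not negative, while [f] is negative on some interval
    that starts just after [tau].  A fine grid has a point there, so the first
    grid point where [f] is negative is close to [tau]: its value is close to
    [0], whereas the remaining time stays above half of [T - tau]. *)
Lemma first_grid_hit (R : realType) (f : R -> R) (T : R) :
  0 < T -> 0 < f 0 ->
  (forall t, 0 <= t -> forall e, 0 < e -> exists2 h, 0 < h &
     forall u, 0 <= u -> `|u - t| < h -> `|f u - f t| < e) ->
  (exists t, [/\ 0 <= t, t < T & f t < 0]) ->
  forall e, 0 < e -> \forall n \near \oo, exists k : nat,
    [/\ (k < n.+1)%N,
        forall j, (j < k)%N -> 0 <= f (T * j%:R / n.+1%:R),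
        f (T * k%:R / n.+1%:R) < 0 &
        - f (T * k%:R / n.+1%:R) <= e * (T - T * k%:R / n.+1%:R)].
Proof.
move=> T0 f0 fc [t0 [t00 t0T ft0]] e e0.
pose A := [set t | [/\ 0 <= t, t < T & f t < 0]].
have A0 : A t0 by [].
have Alb : has_lbound A by exists 0 => x [].
have hA : has_inf A by split => //; exists t0.
pose tau := inf A.
have tau0 : 0 <= tau by apply: lb_le_inf; [exists t0|move=> x []].
have tauT : tau < T by apply: le_lt_trans t0T; exact: ge_inf.
have ftau : 0 <= f tau.
  rewrite leNgt; apply/negP => ftau.
  have tau_gt0 : 0 < tau.
    rewrite lt_neqAle tau0 andbT; apply/eqP => tauE.
    by move: ftau; rewrite -tauE ltNge (ltW f0).
  have [h h0 hf] := fc tau tau0 (- f tau) ltac:(lra).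
  pose u := Num.max 0 (tau - h / 2).
  have u0 : 0 <= u by rewrite le_max lexx.
  have u1 : tau - h / 2 <= u by rewrite le_max lexx orbT.
  have u2 : u < tau by rewrite gt_max tau_gt0/=; lra.
  have fu : `|f u - f tau| < - f tau.
    by apply: hf => //; rewrite ltr_norml; apply/andP; split; lra.
  have : tau <= u.
    apply: ge_inf => //; split => //; first lra.
    by move: fu; rewrite ltr_norml => /andP[]; lra.
  by rewrite leNgt u2.
(* the overshoot allowed by a remaining time of (T - tau) / 2 *)
pose eta := e * ((T - tau) / 2).
have eta0 : 0 < eta by rewrite mulr_gt0//; lra.
have [h h0 hf] := fc tau tau0 eta eta0.
(* before tau + h' the value is at least - eta and half of the time is left *)
pose h' := Num.min h ((T - tau) / 2).
have h'0 : 0 < h' by rewrite lt_min h0/=; lra.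
have h'h : h' <= h by rewrite ge_min lexx.
have h'T : h' <= (T - tau) / 2 by rewrite ge_min lexx orbT.
have [t1 [t10 t1T ft1] t1h] := inf_adherent h'0 hA.
rewrite -/tau in t1h.
have [r r0 rf] := fc t1 t10 (- f t1) ltac:(lra).
pose r' := Num.min r (tau + h' - t1).
have r'0 : 0 < r' by rewrite lt_min r0/=; lra.
have r'r : r' <= r by rewrite ge_min lexx.
have r't : r' <= tau + h' - t1 by rewrite ge_min lexx orbT.
have r'T0 : 0 < r' / T by rewrite divr_gt0.
near=> n.
have nT : T / n.+1%:R < r'.
  rewrite mulrC -ltr_pdivlMr//.
  by near: n; exact: (near_infty_natSinv_lt (PosNum r'T0)).
have n0 : 0 < n.+1%:R :> R by rewrite ltr0n.
pose g (k : nat) := T * k%:R / n.+1%:R.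
have [k gk1 gk2] : exists2 k : nat, t1 <= g k & g k < t1 + r'.
  have t1n : 0 <= t1 * n.+1%:R / T by rewrite divr_ge0 ?mulr_ge0// ltW.
  have /andP[m1 m2] := truncn_itv t1n.
  exists (Num.truncn (t1 * n.+1%:R / T)).+1; rewrite /g.
    by rewrite ler_pdivlMr// [leRHS]mulrC -ler_pdivrMr// ltW.
  apply: (@le_lt_trans _ _ (t1 + T / n.+1%:R)); last by rewrite ltrD2l.
  rewrite -natr1 mulrDr mulr1 mulrDl lerD2r ler_pdivrMr// [leLHS]mulrC.
  by rewrite -ler_pdivlMr.
have fgk : f (g k) < 0.
  have : `|f (g k) - f t1| < - f t1.
    by apply: rf; [lra|rewrite ltr_norml; apply/andP; split; lra].
  by rewrite ltr_norml => /andP[]; lra.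
have exk : exists k, f (g k) < 0 by exists k.
exists (ex_minn exk); case: ex_minnP => m fgm mmin.
have mk := mmin _ fgk.
have gmk : g m <= g k by rewrite /g ler_pM2r ?invr_gt0// ler_pM2l// ler_nat.
have gm0 : 0 <= g m by rewrite divr_ge0 ?mulr_ge0// ltW.
have gmT : g m < T by lra.
have taug : tau <= g m by apply: ge_inf.
split => //.
- by move: gmT; rewrite /g ltr_pdivrMr// ltr_pM2l// ltr_nat.
- by move=> j jm; rewrite leNgt; apply/negP => /mmin; rewrite leqNgt jm.
have : `|f (g m) - f tau| < eta.
  by apply: hf => //; rewrite ltr_norml; apply/andP; split; lra.
rewrite ltr_norml => /andP[fm _].
apply: (@le_trans _ _ eta); first by rewrite -/(g m); lra.
by rewrite ler_wpM2l ?(ltW e0)// -/(g m); lra.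
Unshelve. all: by end_near.
Qed.

(** * The reflection principle for the drifted path *)

Lemma bounded_convergence d (Omega : measurableType d) (R : realType)
    (P : probability Omega R) (f_ : nat -> Omega -> R) (f : Omega -> R) (C : R) :
  (forall n, measurable_fun setT (f_ n)) ->
  (forall n w, 0 <= f_ n w <= C) ->
  (forall w, f_ n w @[n --> \oo] --> f w) ->
  (\int[P]_w (f_ n w)%:E @[n --> \oo] --> \int[P]_w (f w)%:E)%E.
Proof.
move=> mf_ bf_ cf_.
have mf : measurable_fun setT f by apply: (measurable_fun_cvg mf_) => w _.
have [] := @dominated_convergence _ _ _ P _ measurableT
  (fun n w => (f_ n w)%:E) (fun w => (f w)%:E) (cst C%:E).
- by move=> n; apply/measurable_EFinP.
- exact/measurable_EFinP.
- by apply: aeW => w _; apply: cvg_EFin; [exact: nearW|exact: cf_].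
- exact: finite_measure_integrable_cst.
- apply: aeW => w n _; have /andP[f0 fC] := bf_ n w.
  by rewrite /= lee_fin ger0_norm.
by [].
Qed.

Lemma gap_continuous d (Omega : measurableType d) (R : realType)
    (P : probability Omega R) (B : R -> {RV P >-> R})
    (hB : brownian_motion B) (a c : R) (w : Omega) (t : R) :
  0 <= t -> forall e : R, 0 < e -> exists2 h, 0 < h &
     forall u, 0 <= u -> `|u - t| < h -> `|gap B a c u w - gap B a c t w| < e.
Proof.
move=> t0 e e0.
have /subspace_continuousP/(_ t) := @bm_continuous _ _ _ _ _ hB w.
rewrite /= in_itv/= andbT => /(_ t0)/cvgrPdist_lt/(_ (e / 2)).
rewrite divr_gt0// => /(_ isT); rewrite near_withinE => /nbhs_ballP[h1 /= h10 hh1].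
pose h2 := e / 2 / (`|c| + 1).
have c0 : 0 < `|c| + 1 by rewrite ltr_wpDl.
have h20 : 0 < h2 by rewrite !divr_gt0.
exists (Num.min h1 h2); first by rewrite lt_min h10.
move=> u u0; rewrite lt_min => /andP[uh1 uh2].
have := hh1 u; rewrite /ball/= distrC => /(_ uh1).
rewrite in_itv/= u0 => /(_ isT) Bu.
have -> : gap B a c u w - gap B a c t w = c * (u - t) + (B t w - B u w).
  by rewrite /gap; ring.
apply: (le_lt_trans (ler_normD _ _)); rewrite [ltRHS]splitr ler_ltD//.
rewrite normrM; apply: (@le_trans _ _ ((`|c| + 1) * `|u - t|)).
  by rewrite ler_wpM2r// lerDl.
by rewrite mulrC -ler_pdivlMr// ltW.
Qed.

Definition first_hit (Omega : Type) (R : realType) (Y : R -> Omega -> R)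
    (t : nat -> R) (k : nat) : set Omega :=
  [set w | Y (t k) w < 0 /\ forall j, (j < k)%N -> 0 <= Y (t j) w].

Lemma first_hit_measurable d (Omega : measurableType d) (R : realType)
    (P : probability Omega R) (B : R -> {RV P >-> R})
    (hB : brownian_motion B) (t : nat -> R) (k : nat) (a c : R) : t 0%N = 0 ->
  <<s increment_rectangles B t k >> (first_hit (gap B a c) t k).
Proof.
move=> t0.
pose GT : measurableType _ := g_sigma_algebraType (increment_rectangles B t k).
have mF j : (j <= k)%N -> measurable ([set w | gap B a c (t j) w < 0] : set GT).
  move=> jk.
  have mY : measurable_fun setT (gap B a c (t j) : GT -> R).
    by apply: measurable_funB => //; exact: past_measurable.
  rewrite (_ : [set _ | _] = setT `&` gap B a c (t j) @^-1` `]-oo, 0[).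
    exact: mY.
  by rewrite setTI; apply/seteqP; split => w /=; rewrite in_itv.
have -> : first_hit (gap B a c) t k = [set w | gap B a c (t k) w < 0] `&`
    \bigcap_j (if (j < k)%N then ~` [set w | gap B a c (t j) w < 0] else setT).
  apply/seteqP; split => w [/= Yk Yj]; split => //.
    by move=> j _; case: ifPn => // /Yj; rewrite /= leNgt => /negP.
  by move=> j jk; have := Yj j I; rewrite jk /= => /negP; rewrite -leNgt.
have : measurable ([set w | gap B a c (t k) w < 0] `&`
    \bigcap_j (if (j < k)%N then ~` [set w | gap B a c (t j) w < 0] else setT) : set GT).
  apply: measurableI; first exact: mF.
  apply: bigcapT_measurable => j; case: ifPn => // jk.
  by apply: measurableC; apply: mF; exact: ltnW.
by [].
Qed.

Lemma first_hit_inj (Omega : Type) (R : realType) (Y : R -> Omega -> R)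
    (t : nat -> R) (j k : nat) (w : Omega) :
  first_hit Y t j w -> first_hit Y t k w -> j = k.
Proof.
move=> [Yj fj] [Yk fk]; case: (ssrnat.ltngtP j k) => // [/fk|/fj].
  by rewrite leNgt Yj.
by rewrite leNgt Yk.
Qed.

(** The value [phi k w] at the first hitting index [k < n] of the outcome [w],
    and [0] if there is none.  The sum has at most one non-zero term; this form
    makes measurability and integration immediate. *)
Definition at_first_hit (Omega : Type) (R : realType) (Y : R -> Omega -> R)
    (t : nat -> R) (n : nat) (phi : nat -> Omega -> R) (w : Omega) : R :=
  \sum_(k < n) \1_(first_hit Y t k) w * phi k w.

Lemma at_first_hitE (Omega : Type) (R : realType) (Y : R -> Omega -> R)
    (t : nat -> R) (n k : nat) (phi : nat -> Omega -> R) (w : Omega) :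
  (k < n)%N -> first_hit Y t k w -> at_first_hit Y t n phi w = phi k w.
Proof.
move=> kn fk; rewrite /at_first_hit (bigD1 (Ordinal kn))//= big1 ?addr0.
  by rewrite indicE mem_set// mul1r.
move=> i ik; rewrite indicE memNset ?mul0r// => fi.
by move/eqP: ik; apply; apply: val_inj => /=; exact: (first_hit_inj fi fk).
Qed.

Lemma at_first_hit0 (Omega : Type) (R : realType) (Y : R -> Omega -> R)
    (t : nat -> R) (n : nat) (phi : nat -> Omega -> R) (w : Omega) :
  (forall k, (k < n)%N -> ~ first_hit Y t k w) -> at_first_hit Y t n phi w = 0.
Proof.
move=> nf; rewrite /at_first_hit big1// => k _.
by rewrite indicE memNset ?mul0r//; exact: nf.
Qed.

Lemma at_first_hit_bound (Omega : Type) (R : realType) (Y : R -> Omega -> R)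
    (t : nat -> R) (n : nat) (phi : nat -> Omega -> R) (C : R) (w : Omega) :
  0 <= C ->
  (forall k, (k < n)%N -> first_hit Y t k w -> 0 <= phi k w <= C) ->
  0 <= at_first_hit Y t n phi w <= C.
Proof.
move=> C0 phiC.
have [[k kn fk]|nf] := pselect (exists2 k, (k < n)%N & first_hit Y t k w).
  by rewrite (at_first_hitE _ kn fk); exact: phiC.
rewrite at_first_hit0 ?lexx// => k kn fk; apply: nf; by exists k.
Qed.

(** The time [T] is excluded, so that there is always time left at the
    crossing; by continuity no path is lost ([terminal_hit]). *)
Definition hit (Omega : Type) (R : realType) (Y : R -> Omega -> R) (T : R) :
    set Omega :=
  [set w | exists t, [/\ 0 <= t, t < T & Y t w < 0]].

Definition grid (R : realType) (T : R) (n k : nat) : R := T * k%:R / n.+1%:R.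

Lemma grid0 (R : realType) (T : R) (n : nat) : grid T n 0 = 0.
Proof. by rewrite /grid mulr0 mul0r. Qed.

Lemma grid_ge0 (R : realType) (T : R) (n k : nat) : 0 < T -> 0 <= grid T n k.
Proof. by move=> T0; rewrite divr_ge0 ?mulr_ge0// ltW. Qed.

Lemma grid_le (R : realType) (T : R) (n j k : nat) : 0 < T ->
  (j <= k)%N -> grid T n j <= grid T n k.
Proof.
by move=> T0 jk; rewrite /grid ler_pM2r ?invr_gt0 ?ltr0n// ler_pM2l// ler_nat.
Qed.

Lemma grid_lt (R : realType) (T : R) (n k : nat) : 0 < T ->
  (k < n.+1)%N -> grid T n k < T.
Proof.
by move=> T0 kn; rewrite /grid ltr_pdivrMr ?ltr0n// ltr_pM2l// ltr_nat.
Qed.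

Lemma integral_at_first_hit d (Omega : measurableType d) (R : realType)
    (P : probability Omega R) (Y : R -> Omega -> R) (t : nat -> R) (n : nat)
    (phi : nat -> Omega -> R) :
  (forall k, measurable (first_hit Y t k)) ->
  (forall k, measurable_fun setT (phi k)) ->
  (forall k w, (k < n)%N -> first_hit Y t k w -> 0 <= phi k w) ->
  (\int[P]_w (at_first_hit Y t n phi w)%:E =
   \sum_(k < n) \int[P]_(w in first_hit Y t k) (phi k w)%:E)%E.
Proof.
move=> mE mphi phi0.
transitivity (\int[P]_w \sum_(k < n) (\1_(first_hit Y t k) w * phi k w)%:E)%E.
  by apply: eq_integral => w _; rewrite sumEFin.
rewrite ge0_integral_sum//; last 2 first.
- move=> k; apply/measurable_EFinP; apply: measurable_funM => //.
- move=> k w _; rewrite lee_fin indicE.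
  have [|_] := boolP (_ \in _); last by rewrite mul0r.
  by rewrite inE mul1r => /phi0; apply.
apply: eq_bigr => k _; rewrite [RHS]integral_mkcond; apply: eq_integral => w _.
by rewrite patchE indicE; case: (_ \in _); rewrite ?mul1r ?mul0r.
Qed.

Lemma measurable_at_first_hit d (Omega : measurableType d) (R : realType)
    (Y : R -> Omega -> R) (t : nat -> R) (n : nat) (phi : nat -> Omega -> R) :
  (forall k, measurable (first_hit Y t k)) ->
  (forall k, measurable_fun setT (phi k)) ->
  measurable_fun setT (at_first_hit Y t n phi).
Proof.
move=> mE mphi; apply: measurable_sum => k; exact: measurable_funM.
Qed.

(** The sequence is eventually constant for every outcome: a path that
    crosses is caught by every fine enough grid. *)
Lemma at_first_hit_cvg d (Omega : measurableType d) (R : realType)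
    (P : probability Omega R) (B : R -> {RV P >-> R})
    (hB : brownian_motion B) (T a c : R) (f : Omega -> R) (w : Omega) :
  0 < T -> 0 < a ->
  at_first_hit (gap B a c) (grid T n) n.+1 (fun=> f) w @[n --> \oo] -->
  \1_(hit (gap B a c) T) w * f w.
Proof.
move=> T0 a0; rewrite indicE; have [|nH] := boolP (_ \in _).
  rewrite inE => H; rewrite mul1r; apply: cvg_near_cst.
  have Y0 : 0 < gap B a c 0 w.
    by rewrite /gap mulr0 addr0 (bm_start hB) subr0.
  have := first_grid_hit T0 Y0 (@gap_continuous _ _ _ _ _ hB a c w) H ltr01.
  apply: filterS => n [k [kn fk Yk _]].
  by rewrite (at_first_hitE _ kn).
rewrite mul0r; apply: cvg_near_cst; apply: nearW => n.
apply: at_first_hit0 => k kn [Yk _]; move/negP: nH; apply; rewrite inE.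
by exists (grid T n k); rewrite grid_ge0// grid_lt.
Qed.

Lemma hit_measurable d (Omega : measurableType d) (R : realType)
    (P : probability Omega R) (B : R -> {RV P >-> R})
    (hB : brownian_motion B) (T a c : R) :
  0 < T -> 0 < a -> measurable (hit (gap B a c) T).
Proof.
move=> T0 a0; apply/(@measurable_indicP _ _ R).
have mE n k : measurable (first_hit (gap B a c) (grid T n) k).
  apply: past_sub_measurable; exact: (first_hit_measurable hB a c (grid0 T n)).
apply: (@measurable_fun_cvg _ _ _ _
  (fun n => at_first_hit (gap B a c) (grid T n) n.+1 (fun=> cst 1))).
  by move=> n; apply: measurable_at_first_hit.
move=> w _.
by have := @at_first_hit_cvg _ _ _ _ _ hB T a c (cst 1) w T0 a0; rewrite mulr1.
Qed.

Lemma terminal_hit d (Omega : measurableType d) (R : realType)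
    (P : probability Omega R) (B : R -> {RV P >-> R})
    (hB : brownian_motion B) (T a c : R) (w : Omega) :
  0 < T -> gap B a c T w < 0 -> hit (gap B a c) T w.
Proof.
move=> T0 YT.
have [h h0 hY] := gap_continuous hB a c w (ltW T0) (e := - gap B a c T w) ltac:(lra).
pose u := Num.max 0 (T - h / 2).
have u0 : 0 <= u by rewrite le_max lexx.
have u1 : T - h / 2 <= u by rewrite le_max lexx orbT.
have uT : u < T by rewrite gt_max T0/=; lra.
exists u; split => //.
have : `|gap B a c u w - gap B a c T w| < - gap B a c T w.
  by apply: hY => //; rewrite ltr_norml; apply/andP; split; lra.
by rewrite ltr_norml => /andP[]; lra.
Qed.

(** The error terms of [past_event_reflection] at the stopping index vanish
    in the limit: on a crossing path the overshoot becomes small compared with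
    the time left, and the other paths have no hitting index. *)
Lemma overshoot_cvg d (Omega : measurableType d) (R : realType)
    (P : probability Omega R) (B : R -> {RV P >-> R})
    (hB : brownian_motion B) (T a c C K : R) (w : Omega) :
  0 < T -> 0 < a -> 0 < K -> 0 <= C ->
  at_first_hit (gap B a c) (grid T n) n.+1 (fun k w => Num.min C
    (expR (2 * K * (- gap B a c (grid T n k) w / (T - grid T n k))) - 1)) w
  @[n --> \oo] --> (0 : R).
Proof.
move=> T0 a0 K0 C0.
have [H|nH] := pselect (hit (gap B a c) T w); last first.
  apply: cvg_near_cst; apply: nearW => n.
  apply: at_first_hit0 => k kn [Yk _]; apply: nH.
  by exists (grid T n k); rewrite grid_ge0// grid_lt.
have Y0 : 0 < gap B a c 0 w.
  by rewrite /gap mulr0 addr0 (bm_start hB) subr0.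
apply/cvgrPdist_le => e e0.
(* this ratio of overshoot to remaining time gives exactly the error e *)
have e1 : 0 < ln (1 + e) / (2 * K).
  by rewrite divr_gt0 ?mulr_gt0// ln_gt0// ltrDl.
have := first_grid_hit T0 Y0 (@gap_continuous _ _ _ _ _ hB a c w) H e1.
apply: filterS => n [k [kn fk Yk Ye]].
rewrite (at_first_hitE _ kn)//= sub0r normrN.
have s0 : 0 < T - grid T n k by rewrite subr_gt0 grid_lt.
have x0 : 0 <= 2 * K * (- gap B a c (grid T n k) w / (T - grid T n k)).
  apply: mulr_ge0; first lra.
  by rewrite divr_ge0 ?(ltW s0)// oppr_ge0 ltW.
rewrite ger0_norm; last by rewrite le_min C0 subr_ge0 -[leLHS]expR0 ler_expR.
rewrite ge_min; apply/orP; right; rewrite lerBlDl -[leRHS]lnK ?posrE; last lra.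
rewrite ler_expR mulrC -ler_pdivlMr ?mulr_gt0//.
by rewrite ler_pdivrMr.
Qed.

(** Summing [past_event_reflection] over the stopping index encloses the
    weighted expectation between two sequences with the limit
    [P (crossed, 0 < Y_T < K)].  On the right-hand side, every path that
    carries weight ends with [Y_T < 0], and thus has crossed. *)
Lemma reflection_principle d (Omega : measurableType d) (R : realType)
    (P : probability Omega R) (B : R -> {RV P >-> R})
    (hB : brownian_motion B) (T a c K : R) :
  0 < T -> 0 < a -> 0 < K ->
  P (hit (gap B a c) T `&` gap B a c T @^-1` `]0, K[) =
  (\int[P]_w (mirror_weight c K (gap B a c T w))%:E)%E.
Proof.
move=> T0 a0 K0.
set H := hit _ _; set V := _ @^-1` _.
pose C := expR (2 * `|c| * K).
have mH : measurable H by exact: hit_measurable.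
have mY := measurable_gap B a c.
have mV : measurable V by rewrite -[V]setTI; exact: mY.
have mE n k : measurable (first_hit (gap B a c) (grid T n) k).
  apply: past_sub_measurable; exact: (first_hit_measurable hB a c (grid0 T n)).
pose bound n k w := Num.min C
  (expR (2 * K * (- gap B a c (grid T n k) w / (T - grid T n k))) - 1).
pose S1 n := at_first_hit (gap B a c) (grid T n) n.+1 (fun=> \1_V : Omega -> R).
pose S2 n := at_first_hit (gap B a c) (grid T n) n.+1
  (fun _ w => mirror_weight c K (gap B a c T w)).
pose S3 n := at_first_hit (gap B a c) (grid T n) n.+1 (bound n).
have mM : measurable_fun setT (fun w => mirror_weight c K (gap B a c T w)).
  exact: (measurableT_comp (measurable_mirror_weight c K)).
have mb n k : measurable_fun setT (bound n k).
  exact: (measurableT_comp (measurable_mirror_bound _ K _) (mY _)).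
have b0 n k w : (k < n.+1)%N -> first_hit (gap B a c) (grid T n) k w ->
    0 <= bound n k w.
  move=> kn [Yk _]; apply: mirror_bound_ge0; [exact: ltW|by rewrite subr_gt0 grid_lt|exact: ltW].
have cvg1 : (\int[P]_w (S1 n w)%:E @[n --> \oo] --> P (H `&` V))%E.
  have -> : P (H `&` V) = (\int[P]_w (\1_H w * \1_V w)%:E)%E.
    transitivity (\int[P]_w (\1_(H `&` V) w)%:E)%E.
      by rewrite integral_indic ?setIT//; exact: measurableI.
    by apply: eq_integral => w _; rewrite indicI.
  apply: (bounded_convergence (C := 1)).
  - by move=> n; apply: measurable_at_first_hit.
  - by move=> n w; apply: at_first_hit_bound => // k _ _; rewrite indicE; case: (_ \in _); rewrite lexx ler01.
  - by move=> w; exact: at_first_hit_cvg.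
have cvg2 : (\int[P]_w (S2 n w)%:E @[n --> \oo] -->
    \int[P]_w (mirror_weight c K (gap B a c T w))%:E)%E.
  have -> : (\int[P]_w (mirror_weight c K (gap B a c T w))%:E =
     \int[P]_w (\1_H w * mirror_weight c K (gap B a c T w))%:E)%E.
    apply: eq_integral => w _; rewrite indicE.
    have [_|] := boolP (w \in H); first by rewrite mul1r.
    rewrite notin_setE => nH; rewrite mul0r /mirror_weight indicE memNset ?mulr0//=.
    rewrite in_itv/= => /andP[_ YT]; apply: nH; exact: terminal_hit.
  apply: (bounded_convergence (C := C)).
  - by move=> n; apply: measurable_at_first_hit.
  - move=> n w; apply: at_first_hit_bound; first exact: expR_ge0.
    by move=> k _ _; rewrite mirror_weight_ge0 mirror_weight_le.
  - by move=> w; exact: at_first_hit_cvg.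
have cvg3 : (\int[P]_w (S3 n w)%:E @[n --> \oo] --> 0)%E.
  rewrite -(integral0 P setT).
  apply: (bounded_convergence (f := cst 0) (C := C)).
  - by move=> n; apply: measurable_at_first_hit.
  - move=> n w; apply: at_first_hit_bound; first exact: expR_ge0.
    by move=> k kn fk; rewrite b0//= ge_min lexx.
  - by move=> w; apply: overshoot_cvg => //; exact: expR_ge0.
have step n : (\int[P]_w (S1 n w)%:E <= \int[P]_w (S2 n w)%:E
               <= \int[P]_w (S1 n w)%:E + \int[P]_w (S3 n w)%:E)%E.
  have mVf : measurable_fun setT (\1_V : Omega -> R) by exact: measurable_indic.
  rewrite (integral_at_first_hit P (mE n) (fun=> mVf))//.
  rewrite (integral_at_first_hit P (mE n) (fun=> mM)); last first.
    by move=> k w _ _; exact: mirror_weight_ge0.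
  rewrite (integral_at_first_hit P (mE n) (mb n) (b0 n)).
  have eqV k : (\int[P]_(w in first_hit (gap B a c) (grid T n) k) (\1_V w)%:E =
      P (first_hit (gap B a c) (grid T n) k `&` V))%E.
    by rewrite integral_indic// setIC.
  have ms k (kn : (k < n.+1)%N) := past_event_reflection hB (c := c) (a := a) (grid0 T n)
    (fun i _ => grid_le n T0 (leqnSn i)) (grid_ge0 n k T0) (grid_lt T0 kn)
    (first_hit_measurable hB a c (grid0 T n)) (ltW K0) (fun w fw => ltW fw.1).
  rewrite -big_split /=; apply/andP; split; apply: lee_sum => k _.
    by rewrite eqV; have /andP[] := ms k (ltn_ord k).
  by rewrite eqV; have /andP[] := ms k (ltn_ord k).
apply/eqP; rewrite eq_le; apply/andP; split.
  apply: (lee_cvg_to cvg1 cvg2); apply: nearW => n.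
  by have /andP[] := step n.
rewrite -[leRHS]adde0; apply: (lee_cvg_to cvg2 (cvgeD _ cvg1 cvg3)).
  by rewrite fin_num_adde_defl.
by apply: nearW => n; have /andP[] := step n.
Qed.

(** * The law of the first crossing *)

Lemma bounded_rays_bigcup (R : realType) (b : R) :
  \bigcup_n `]b, b + n.+1%:R[%classic = `]b, +oo[%classic.
Proof.
apply/seteqP; split => x /=; first by move=> [n _]; rewrite /= !in_itv/= => /andP[->].
rewrite in_itv/= andbT => bx; exists (Num.truncn (x - b)) => //=.
by rewrite in_itv/= bx/= addrC -ltrBlDr truncnS_gt.
Qed.

Lemma bounded_rays_nondecreasing (R : realType) (b : R) :
  {homo (fun n => `]b, b + n.+1%:R[%classic) : n m / (n <= m)%N >-> (n <= m)%O}.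
Proof.
move=> n m nm; apply/subsetPset => x /=; rewrite !in_itv/= => /andP[-> xn].
by rewrite (lt_le_trans xn)// lerD2l ler_nat.
Qed.

(** Removes the truncation at [K] along the integers. *)
Lemma cvg_measure_bounded_rays d (Omega : measurableType d) (R : realType)
    (mu : {measure set Omega -> \bar R}) (A : set Omega) (X : Omega -> R) (b : R) :
  measurable A -> measurable_fun setT X ->
  (mu (A `&` X @^-1` `]b, (b + n.+1%:R)%R[) @[n --> \oo] -->
   mu (A `&` X @^-1` `]b, +oo[))%E.
Proof.
move=> mA mX.
have mV (i : interval R) : measurable (A `&` X @^-1` [set` i]).
  apply: measurableI => //; rewrite -[Y in measurable Y]setTI.
  exact: mX.
rewrite -bounded_rays_bigcup preimage_bigcup setI_bigcupr.
apply: (nondecreasing_cvg_mu (mu := mu)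
  (F := fun n => A `&` X @^-1` `]b, b + n.+1%:R[)) => //.
  by apply: bigcupT_measurable => n; exact: mV.
move=> n m nm; apply/subsetPset; apply: setIS; apply: preimage_subset.
by apply/subsetPset; exact: bounded_rays_nondecreasing.
Qed.

Lemma brownian_marginal d (Omega : measurableType d) (R : realType)
    (P : probability Omega R) (B : R -> {RV P >-> R})
    (hB : brownian_motion B) (T : R) (A : set R) : 0 < T -> measurable A ->
  P (B T @^-1` A) = normal_prob 0 (Num.sqrt T) A.
Proof.
move=> T0 mA; have := bm_gaussian hB (lexx 0) T0 mA; rewrite subr0 => <-.
rewrite /distribution /pushforward (_ : (B T - B 0 : {mfun Omega >-> R}) = B T :> (_ -> _))//.
apply/funext => w; transitivity (B T w - B 0 w) => //.
by rewrite (bm_start hB) subr0.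
Qed.

Lemma integral_mirror_weight_gap d (Omega : measurableType d) (R : realType)
    (P : probability Omega R) (B : R -> {RV P >-> R})
    (hB : brownian_motion B) (a c K T : R) : 0 < T ->
  (\int[P]_w (mirror_weight c K (gap B a c T w))%:E =
   (expR (- (2 * a * c)))%:E *
   normal_prob (2 * c * T) (Num.sqrt T) `](a + c * T)%R, (a + c * T + K)%R[)%E.
Proof.
move=> T0; rewrite -integral_mirror_weight_start//.
have mX : measurable_fun setT (B T : Omega -> measurableTypeR R).
  by have : measurable_fun setT (B T) by [].
pose X : {mfun Omega >-> measurableTypeR R} :=
  HB.pack (B T : Omega -> measurableTypeR R) (isMeasurableFun.Build _ _ _ _ _ mX).
transitivity (\int[distribution P X]_x
    (mirror_weight c K (a + c * T - x)%R)%:E)%E.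
  rewrite ge0_integral_distribution//.
  - apply/measurable_EFinP; apply: (measurableT_comp (measurable_mirror_weight c K)).
    exact: measurable_funB.
  - by move=> x; rewrite lee_fin mirror_weight_ge0.
apply: eq_measure_integral => A mA _.
exact: (brownian_marginal hB T0 mA).
Qed.

(** The event is split according to the sign of the gap at time [T]; paths
    that end exactly on the line form a null set. *)
Lemma hitting_probability d (Omega : measurableType d) (R : realType)
    (P : probability Omega R) (B : R -> {RV P >-> R})
    (hB : brownian_motion B) (T a c : R) : 0 < T -> 0 < a ->
  P (hit (gap B a c) T) =
  (Psi ((a + c * T) / Num.sqrt T) +
   (expR (- (2 * a * c)))%:E * Psi ((a - c * T) / Num.sqrt T))%E.
Proof.
move=> T0 a0.
have sT0 : 0 < Num.sqrt T by rewrite sqrtr_gt0.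
set H := hit _ _; set b := a + c * T.
have mH : measurable H by exact: hit_measurable.
have mY := measurable_gap B a c T.
have mV (i : interval R) : measurable (gap B a c T @^-1` [set` i]).
  by rewrite -[X in measurable X]setTI; exact: mY.
have above : P (H `&` gap B a c T @^-1` `]-oo, 0]) = Psi (b / Num.sqrt T).
  have -> : Psi (b / Num.sqrt T) = normal_prob 0 (Num.sqrt T) `]b, +oo[.
    by rewrite normal_prob_ray// subr0.
  apply/eqP; rewrite eq_le; apply/andP; split.
    have -> : normal_prob 0 (Num.sqrt T) `]b, +oo[ =
              normal_prob 0 (Num.sqrt T) `[b, +oo[.
      rewrite /normal_prob integral_itv_obnd_cbnd//; apply: measurable_funTS.
      by apply/measurable_EFinP; exact: measurable_normal_pdf.
    rewrite -(brownian_marginal hB T0)//; apply: le_measure; rewrite ?inE//.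
    - exact: measurableI.
    - exact: measurable_funPTI.
    - by move=> w /= [_]; rewrite !in_itv/= /gap -/b subr_le0 andbT.
  rewrite -(brownian_marginal hB T0)//; apply: le_measure; rewrite ?inE//.
  - exact: measurable_funPTI.
  - exact: measurableI.
  - move=> w /=; rewrite !in_itv/= andbT => bB.
    have YT : gap B a c T w < 0 by rewrite /gap -/b subr_lt0.
    by split; [exact: terminal_hit|rewrite ltW].
have below : P (H `&` gap B a c T @^-1` `]0, +oo[) =
    ((expR (- (2 * a * c)))%:E * Psi ((a - c * T) / Num.sqrt T))%E.
  have -> : Psi ((a - c * T) / Num.sqrt T) =
      normal_prob (2 * c * T) (Num.sqrt T) `]b, +oo[.
    by rewrite normal_prob_ray//; congr (Psi (_ / _)); rewrite /b; ring.
  have cP := cvg_measure_bounded_rays (mu := P) (b := 0) mH mY.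
  have cN := @cvg_measure_bounded_rays _ (measurableTypeR R) R
    (normal_prob (2 * c * T) (Num.sqrt T)) setT id b measurableT
    (@measurable_id _ _ _).
  rewrite -(cvg_lim _ cP)//; apply: cvg_lim => //.
  rewrite setTI in cN.
  have := cvgeZl (isT : (expR (- (2 * a * c)))%:E \is a fin_num) cN.
  apply: cvg_trans; apply: near_eq_cvg.
  apply: nearW => n; rewrite setTI add0r.
  rewrite -[RHS]/(P (H `&` gap B a c T @^-1` `]0, n.+1%:R[)).
  by rewrite (reflection_principle hB)// integral_mirror_weight_gap.
rewrite -above -below -measureU//; last 3 first.
- exact: measurableI.
- exact: measurableI.
- rewrite -subset0 => w [[_ /= Y1] [_ /= Y2]]; move: Y1 Y2; rewrite !in_itv/= andbT; lra.
congr (P _); rewrite -setIUr -preimage_setU.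
rewrite (_ : _ `|` _ = setT) ?preimage_setT ?setIT//.
by apply/seteqP; split => // x _ /=; rewrite !in_itv/= andbT; case: (leP x 0); [left|right].
Qed.

Lemma sup_drifted_gt d (Omega : measurableType d) (R : realType)
    (P : probability Omega R) (B : R -> {RV P >-> R}) (T a c : R) (w : Omega) :
  (a%:E < sup_drifted B T c w)%E <->
  exists2 t, 0 <= t <= T & gap B a c t w < 0.
Proof.
split=> [/ereal_sup_gt[_ [t tT <-]]|[t tT Yt]].
  rewrite lte_fin => at_; exists t; first by move: tT; rewrite /= in_itv.
  by rewrite /gap; lra.
apply: (@lt_le_trans _ _ (B t w - c * t)%:E).
  by rewrite lte_fin; move: Yt; rewrite /gap; lra.
by apply: ereal_sup_ubound; exists t => //=; rewrite in_itv.
Qed.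

Theorem theorem2p1 (R : realType) (d : measure_display)
    (Omega : measurableType d) (P : probability Omega R)
    (B : R -> {RV P >-> R}) (hB : brownian_motion B)
    (T c1 c2 a1 a2 : R) (hT : 0 < T) (hc : c2 < c1)
    (ha1 : 0 < a1) (ha : a1 < a2)
    (htstar : T <= (a2 - a1) / (c1 - c2)) :
  pi_T B T c1 c2 a1 a2 =
  (Psi ((a2 + c2 * T) / Num.sqrt T) +
   (expR (- (2 * a2 * c2)))%:E * Psi ((a2 - c2 * T) / Num.sqrt T))%E.
Proof.
rewrite -(hitting_probability hB)//; last exact: lt_trans ha.
congr (P _); apply/seteqP; split=> w.
  move=> [_ /sup_drifted_gt[t /andP[t0]]].
  rewrite le_eqVlt => /orP[/eqP -> YT|tT Yt]; first exact: terminal_hit.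
  by exists t.
move=> [t [t0 tT Yt]]; split; apply/sup_drifted_gt; exists t => //; rewrite ?t0 ?ltW//.
have : (c1 - c2) * t <= a2 - a1.
  rewrite mulrC -ler_pdivlMr ?subr_gt0//.
  exact: le_trans (ltW tT) htstar.
by move: Yt; rewrite /gap; lra.
Qed.
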